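(* Let $Q$ be an irreducible Markov generator on a finite state space $\mathcal X$, reversible with respect to a probability measure $\pi$. Then its log-Sobolev constant $t_{\mathrm{LS}}$, its modified log-Sobolev constant $t_{\mathrm{MLS}}$ and its sparsity parameter $p$ satisfy $$t_{\mathrm{LS}}\ \le\ 20\, t_{\mathrm{MLS}}\,\log\left(\frac1p\right).$$
   Context: $Q$ is a continuous-time Markov generator: $Q(x,y)\ge 0$ for $x\ne y$ and rows sum to $0$. Reversibility: $\pi(x)Q(x,y)=\pi(y)Q(y,x)$ for all $x,y\in\mathcal X$. $\mathbf E[\cdot]$ denotes expectation with respect to $\pi$, and $\log$ is the natural logarithm. Dirichlet form: for $f,g:\mathcal X\to\mathbb R$, $\mathcal E(f,g)=\frac12\sum_{x,y\in\mathcal X}\pi(x)Q(x,y)(f(x)-f(y))(g(x)-g(y))$. Entropy: for $f:\mathcal X\to(0,\infty)$, $\mathrm{Ent}(f)=\mathbf E[f\log f]-\mathbf E[f]\log\mathbf E[f]$. $t_{\mathrm{LS}}$ is the optimal (smallest) constant $t$ such that $\mathrm{Ent}(f)\le t\,\mathcal E(\sqrt f,\sqrt f)$ for all $f:\mathcal X\to(0,\infty)$. $t_{\mathrm{MLS}}$ is the optimal (smallest) constant $t$ such that $\mathrm{Ent}(f)\le t\,\mathcal E(f,\log f)$ for all $f:\mathcal X\to(0,\infty)$. Allowed transitions: $E=\{(x,y)\in\mathcal X^2: Q(x,y)>0\}$, a symmetric set. Total jump rate at $x$: $Q(x)=\sum_{y\in\mathcal X\setminus\{x\}}Q(x,y)$.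 Sparsity parameter: $p=\min_{(x,y)\in E}\frac{Q(x,y)}{\max(Q(x),\,Q(y,x))}$.
   Formalization: For two-state chains the formal theorem additionally assumes p ≤ 1/2, because the printed inequality fails for two states with p near 1 (e.g. Q(a,b)=Q(b,a)=1 gives p=1 and log(1/p)=0 but t_LS>0); with three or more states nothing is added. *)

(* Defs.v *)
From mathcomp Require Import all_boot all_order all_algebra.
From mathcomp Require Import all_classical all_reals all_analysis.

Set Implicit Arguments.
Unset Strict Implicit.
Unset Printing Implicit Defensive.

Import Order.TTheory GRing.Theory Num.Theory.

Local Open Scope classical_set_scope.
Local Open Scope ring_scope.

Section MarkovGenerator.
Variables (R : realType) (X : finType).
Implicit Types (Q : X -> X -> R) (pi f g : X -> R) (x y : X).

Definition generator Q : Prop :=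
  (forall x y, x != y -> 0 <= Q x y) /\ (forall x, \sum_y Q x y = 0).

(* For a generator the diagonal of [Q] is nonpositive, so allowed transitions
   always join two distinct states. *)
Definition allowed Q : rel X := fun x y => 0 < Q x y.

Definition irreducible Q : Prop := forall x y, connect (allowed Q) x y.

Definition probability_mass pi : Prop :=
  (forall x, 0 <= pi x) /\ \sum_x pi x = 1.

Definition reversible Q pi : Prop :=
  forall x y, pi x * Q x y = pi y * Q y x.

Definition expect pi f : R := \sum_x pi x * f x.

Definition dirichlet Q pi f g : R :=
  2^-1 * \sum_x \sum_y pi x * Q x y * (f x - f y) * (g x - g y).

Definition entropy pi f : R :=
  expect pi (fun x => f x * ln (f x)) - expect pi f * ln (expect pi f).

Definition LS_constants Q pi : set R :=
  [set t | forall f, (forall x, 0 < f x) ->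
    entropy pi f <= t * dirichlet Q pi (Num.sqrt \o f) (Num.sqrt \o f)].

Definition MLS_constants Q pi : set R :=
  [set t | forall f, (forall x, 0 < f x) ->
    entropy pi f <= t * dirichlet Q pi f (@ln R \o f)].

(* When [Q] is irreducible and there are at least two states, both sets of
   constants are nonempty, closed and bounded below by [0], so that the infima
   are minima.  With a single state every real is admissible and [inf] takes
   its default value [0]. *)
Definition t_LS Q pi : R := inf (LS_constants Q pi).

Definition t_MLS Q pi : R := inf (MLS_constants Q pi).

Definition jump_rate Q x : R := \sum_(y | y != x) Q x y.

(* Every ratio is at most [1], since [Q x y <= jump_rate Q x] for [y != x]:
   starting the iterated minimum at [1] only matters when there is no allowed
   transition at all, i.e. for a single state. *)
Definition sparsity Q : R :=
  \big[Num.min/1]_(e : X * X | allowed Q e.1 e.2)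
    (Q e.1 e.2 / Num.max (jump_rate Q e.1) (Q e.2 e.1)).

End MarkovGenerator.

(* Main.v *)
Require Import Defs.
From mathcomp Require Import all_boot all_order all_algebra.
From mathcomp Require Import all_classical all_reals all_analysis.
From mathcomp Require Import ring lra.

Set Implicit Arguments.
Unset Strict Implicit.
Unset Printing Implicit Defensive.

Import Order.TTheory GRing.Theory Num.Theory.

Local Open Scope ring_scope.

(* Since [E(f, ln f)] and [E(sqrt f, sqrt f)] are comparable, up to a factor
   logarithmic in [k], when [sqrt f] varies by a factor at most [k] along edges,
   it suffices to find nearly extremal functions of the log-Sobolev inequality
   that are regular in this sense.  Normalise [f] so that [E f = 1] and let
   [g = sqrt f].  If [g y > (2 / p) max(g x, 1)] for an edge [x -> y], replacing
   [g x] by [2 max(g x, 1)] does not decrease the entropy and decreases the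
   Dirichlet form by at least [pi x * jump_rate Q x]; this is impossible when
   [f] is close enough to extremal.  Hence the truncation [max(f, 1)] satisfies
   [E(max(f, 1), ln max(f, 1)) <= C ln(1 / p) E(g, g)].  The truncation costs at
   most [9/2 Var(g)] in entropy, and linearising the modified log-Sobolev
   inequality at constants gives [Var(g) <= 2 t_MLS E(g, g)]. *)

(** * Elementary inequalities for the logarithm *)

Lemma ge0_derive_le (R : realType) (f df : R -> R) (a b : R) : a <= b ->
  (forall x, a <= x -> is_derive x 1 f (df x)) ->
  (forall x, a <= x -> 0 <= df x) -> f a <= f b.
Proof.
move=> ab fdf df0.
have [x /itvP xab||c cab E] := @MVT_segment R f df a b ab.
- by apply: fdf; rewrite xab.
- apply: derivable_within_continuous => x /itvP xab.
  by have [] := fdf x; rewrite ?xab.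
- rewrite -subr_ge0 E mulr_ge0 ?subr_ge0//.
  by rewrite df0// (itvP cab).
Qed.

Lemma ln_le_subr1 (R : realType) (x : R) : 0 < x -> ln x <= x - 1.
Proof.
by move=> x0; have := @le_ln1Dx R (x - 1); rewrite subrKC; apply; lra.
Qed.

Lemma ln_ge_1subV (R : realType) (x : R) : 0 < x -> 1 - x^-1 <= ln x.
Proof.
move=> x0; have := @ln_le_subr1 R x^-1; rewrite invr_gt0 lnV// => /(_ x0); lra.
Qed.

Lemma xln_le_half (R : realType) (x : R) : 1 <= x ->
  2 * (x * ln x) <= x ^+ 2 - 1.
Proof.
move=> x1.
have := @ge0_derive_le R (fun x => x ^+ 2 - 2 * (x * ln x))
  (fun x => 2 * x - 2 * (ln x + 1)) 1 x x1.
rewrite ln1 => h.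
suff : 1 ^+ 2 - 2 * (1 * 0) <= x ^+ 2 - 2 * (x * ln x) by lra.
apply: h => y y1; have y0 : 0 < y by lra.
- have ? := is_derive1_ln y0.
  apply: is_derive_eq; rewrite /GRing.scale/= -?mulr_regl /= mulfV ?gt_eqF//.
  by rewrite ?expr1; ring.
- by have := ln_le_subr1 y0; lra.
Qed.

(** The Padé bound for [ln], exact to second order at 1: the difference of the two sides has
    derivative [ln y + 1 / y - 1], which is nonnegative. *)
Lemma ln_ge_frac (R : realType) (x : R) : 1 <= x ->
  2 * (x - 1) <= (x + 1) * ln x.
Proof.
move=> x1.
have := @ge0_derive_le R (fun x => (x + 1) * ln x - 2 * x)
  (fun x => ln x + (x + 1) * x^-1 - 2) 1 x x1.
rewrite ln1 => h.
suff : (1 + 1) * 0 - 2 * 1 <= (x + 1) * ln x - 2 * x by lra.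
apply: h => y y1; have y0 : 0 < y by lra.
- have ? := is_derive1_ln y0.
  apply: is_derive_eq; rewrite /GRing.scale/=; ring.
- have := ln_ge_1subV y0; rewrite mulrDl mul1r mulfV ?gt_eqF//; lra.
Qed.

(* [(u + 1) / (u - 1) * ln u] is nondecreasing for [u > 1]; stated without
   division so that [u = 1] is included. *)
Lemma frac_ln_mono (R : realType) (u k : R) : 1 <= u -> u <= k ->
  (u + 1) * ln u * (k - 1) <= (k + 1) * ln k * (u - 1).
Proof.
move=> u1 uk; have u0 : 0 < u by lra.
have := @ge0_derive_le R
  (fun k => (k + 1) * ln k * (u - 1) - (u + 1) * ln u * (k - 1))
  (fun k => (ln k + (k + 1) * k^-1) * (u - 1) - (u + 1) * ln u) u k uk.
rewrite subrr => h; rewrite -subr_ge0; apply: h => y uy.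
- have y0 : 0 < y by lra.
  have ? := is_derive1_ln y0.
  apply: is_derive_eq; rewrite /GRing.scale/=; ring.
- have y0 : 0 < y by lra.
  have yu0 : 0 < y / u by rewrite divr_gt0.
  have := ln_ge_1subV yu0; rewrite ln_div ?posrE// invf_div => lnyu.
  have -> : (y + 1) / y = 1 + y^-1 by field; rewrite gt_eqF.
  have h2 : y^-1 <= u^-1 by rewrite lef_pV2 ?posrE.
  have h3 : u * u^-1 = 1 by rewrite mulfV ?gt_eqF.
  have h4 : u^-1 - y^-1 <= 1 - u / y.
    by rewrite -h3 -mulrBr ler_peMl// subr_ge0.
  (* As [ln v + 1 / v] is nondecreasing for [v >= 1], the derivative is least at [y = u], where [h6]
     reduces its sign to [xln_le_half]. *)
  have h5 : ln u + 1 + u^-1 <= ln y + (1 + y^-1) by lra.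
  have h6 : 0 <= (u - 1) * (ln u + 1 + u^-1) - (u + 1) * ln u.
    have := xln_le_half u1 => h7.
    have -> : (u - 1) * (ln u + 1 + u^-1) - (u + 1) * ln u =
      u^-1 * (u ^+ 2 - 1 - 2 * (u * ln u)) by field; rewrite gt_eqF.
    by apply: mulr_ge0; [rewrite invr_ge0 ltW | lra].
  have h7 : (u - 1) * (ln u + 1 + u^-1) <= (u - 1) * (ln y + (1 + y^-1)).
    by rewrite ler_wpM2l//; lra.
  lra.
Qed.

(** Applied to 2 directly, [ln_ge_frac] gives only 2/3, short of the 27/40 on which
    [reg_cost_sparse] relies; the factors 4/3 and 3/2 give 2/7 + 2/5. *)
Lemma ln2_ge (R : realType) : 24 / 35 <= ln 2 :> R.
Proof.
have h1 := @ln_ge_frac R (4 / 3) ltac:(lra).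
have h2 := @ln_ge_frac R (3 / 2) ltac:(lra).
have -> : 2 = 4 / 3 * (3 / 2) :> R by field.
by rewrite lnM ?posrE; lra.
Qed.

(* The chord of the convex function [v ln v] between [1] and [2]. *)
Lemma xln_chord (R : realType) (s : R) : 0 <= s <= 1 ->
  (1 + s) * ln (1 + s) <= s * (2 * ln 2).
Proof.
move=> /andP[s0 s1]; have v0 : 0 < 1 + s by lra.
(* Up to scaling, [h1] and [h2] compare [v ln v] with its tangent at [1 + s], at the points 1 and 2;
   they are combined with weights [1 - s] and [s]. *)
have h1 := ln_le_subr1 v0.
have h2 := @ln_ge_1subV R (2 / (1 + s)) ltac:(by rewrite divr_gt0).
move: h2; rewrite ln_div ?posrE// invf_div => h2.
have h3 : (1 - s) * (ln (1 + s) - s) <= 0 by rewrite mulr_ge0_le0; lra.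
have h4 : 0 <= s * (ln 2 - ln (1 + s) - (1 - (1 + s) / 2)).
  by rewrite mulr_ge0//; lra.
have h1' : 1 - s - (1 - s) * (1 + s) + (1-s) * ln (1+s) <= 0 by lra.
lra.
Qed.

Lemma xln_mono (R : realType) (x y : R) : 1 <= x -> x <= y ->
  x * ln x <= y * ln y.
Proof.
move=> x1 xy; rewrite ler_pM ?ln_ge0//; first lra.
by rewrite ler_ln ?posrE; lra.
Qed.

(* The constant relating [E(f, ln f)] to [E(sqrt f, sqrt f)] when [sqrt f]
   varies by a factor at most [k] along edges. *)
Definition reg_cost (R : realType) (k : R) : R := 2 * (k + 1) / (k - 1) * ln k.

(** Both sides are homogeneous in [(a, b)], so only [u = b / a] matters. The optimal constant for
    the ratio [u] is [reg_cost u], which [frac_ln_mono] shows to be largest at [u = k]. *)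
Lemma sqr_ln_le (R : realType) (k a b : R) : 1 < k -> 0 < a -> a <= b ->
  b <= k * a ->
  (b ^+ 2 - a ^+ 2) * (ln (b ^+ 2) - ln (a ^+ 2)) <=
  reg_cost k * (b - a) ^+ 2.
Proof.
move=> k1 a0 ab bka; have b0 : 0 < b by lra.
have u1 : 1 <= b / a by rewrite ler_pdivlMr// mul1r.
have uk : b / a <= k by rewrite ler_pdivrMr.
have := frac_ln_mono u1 uk; set u := b / a in u1 uk * => hu.
have -> : b = u * a by rewrite /u divfK// gt_eqF.
clearbody u.
have u0 : 0 < u by lra.
have -> : ln ((u * a) ^+ 2) - ln (a ^+ 2) = 2 * ln u.
  by rewrite !lnXn ?mulr_gt0// (lnM u0 a0); ring.
have -> : ((u * a) ^+ 2 - a ^+ 2) * (2 * ln u) =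
  (2 * a ^+ 2 * (u - 1)) * ((u + 1) * ln u) by ring.
have -> : reg_cost k * (u * a - a) ^+ 2 =
  (2 * a ^+ 2 * (u - 1)) * ((k + 1) * ln k * (u - 1) / (k - 1)).
  by rewrite /reg_cost; field; rewrite subr_eq0 gt_eqF.
rewrite ler_wpM2l//; last by rewrite ler_pdivlMr//; lra.
by rewrite !mulr_ge0 ?sqr_ge0//; lra.
Qed.

(** Truncation commutes with squaring and does not increase distances, and the truncated values
    differ by a factor at most [k], so [sqr_ln_le] applies to them. *)
Lemma trunc_edge (R : realType) (k a b : R) : 1 < k -> 0 < a -> 0 < b ->
  b <= k * Num.max a 1 -> a <= k * Num.max b 1 ->
  (Num.max (a ^+ 2) 1 - Num.max (b ^+ 2) 1) *
  (ln (Num.max (a ^+ 2) 1) - ln (Num.max (b ^+ 2) 1)) <=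
  reg_cost k * (a - b) ^+ 2.
Proof.
move=> k1; have C0 : 0 <= reg_cost k.
  by rewrite /reg_cost mulr_ge0 ?divr_ge0 ?ln_ge0//; lra.
have maxE (x : R) : 0 < x -> Num.max (x ^+ 2) 1 = Num.max x 1 ^+ 2.
  move=> x0; case: (leP x 1) => x1.
    by rewrite (max_idPr _) ?expr1n// expr_le1// ltW.
  by rewrite (max_idPl _)// ltW// exprn_egt1.
wlog ab : a b / b <= a => [H a0 b0 h1 h2|a0 b0 _ h].
  have [ba|/ltW ab] := leP b a; first exact: H.
  rewrite -[(a - b) ^+ 2]sqrrN opprB.
  apply: le_trans (H b a ab b0 a0 h2 h1).
  by rewrite -mulrNN !opprB.
rewrite !maxE//.
have bm0 : 0 < Num.max b 1 by rewrite lt_max ltr01 orbT.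
have bma : Num.max b 1 <= Num.max a 1 by rewrite ge_max !le_max ab lexx orbT.
have hk : Num.max a 1 <= k * Num.max b 1.
  rewrite ge_max h/= (@le_trans _ _ (Num.max b 1))//.
    by rewrite le_max lexx orbT.
  by rewrite ler_peMl// ltW.
apply: le_trans (sqr_ln_le k1 bm0 bma hk) _.
rewrite ler_wpM2l// ler_sqr ?nnegrE ?subr_ge0//.
case: (leP a 1) => a1; case: (leP b 1) => b1; lra.
Qed.

(** As [d] tends to 0 the constant tends to 1/2, the true second-order coefficient. The case
    [u >= 0] follows from [ln_ge_frac], the case [u < 0] from [xln_le_half] at [1 / (1 + u)]. *)
Lemma xln_quad (R : realType) (d u : R) : 0 < d < 1 -> - d <= u <= d ->
  u ^+ 2 / (2 * (1 + d)) <= (1 + u) * ln (1 + u) - u.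
Proof.
move=> /andP[d0 d1] /andP[ud1 ud2].
have v0 : 0 < 1 + u by lra.
rewrite ler_pdivrMr; last lra.
have [u0|u0] := leP 0 u.
  have := @ln_ge_frac R (1 + u) ltac:(lra) => h.
  have h1 : 0 <= (1 + u) * ((1 + u + 1) * ln (1 + u) - 2 * u).
    by rewrite mulr_ge0; lra.
  have h2 : u ^+ 2 <= ((1 + u) * ln (1 + u) - u) * (2 + u) by lra.
  apply: (le_trans h2); rewrite ler_wpM2l//; last lra.
  rewrite -(@pmulr_rge0 R (2 + u)); last lra.
  by rewrite mulrC (le_trans _ h2)// sqr_ge0.
have w1 : 1 <= (1 + u)^-1 by rewrite invf_ge1; lra.
have := xln_le_half w1; rewrite lnV ?posrE// => h.
have h1 : 0 <= (1 + u) ^+ 2 *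
    ((1 + u)^-1 ^+ 2 - 1 - 2 * ((1 + u)^-1 * - ln (1 + u))).
  by rewrite mulr_ge0 ?sqr_ge0//; lra.
have {}h1 : 0 <= 1 - (1 + u) ^+ 2 + 2 * ((1 + u) * ln (1 + u)).
  apply: le_trans h1 _; rewrite le_eqVlt; apply/orP; left; apply/eqP.
  by field; rewrite gt_eqF.
have h2 : u ^+ 2 <= ((1 + u) * ln (1 + u) - u) * 2 by lra.
apply: (le_trans h2); rewrite ler_wpM2l//; last lra.
by have := sqr_ge0 u; lra.
Qed.

Lemma sub_ln_le (R : realType) (m a b : R) : 0 < m -> m <= a -> m <= b ->
  (a - b) * (ln a - ln b) <= (a - b) ^+ 2 / m.
Proof.
move=> m0; wlog ba : a b / b <= a => [H ma mb|ma mb].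
  have [ba|/ltW ab] := leP b a; first exact: H.
  by rewrite -mulrNN -sqrrN !opprB; exact: H.
have a0 : 0 < a by lra.
have b0 : 0 < b by lra.
rewrite expr2 -mulrA ler_wpM2l ?subr_ge0//.
rewrite -ln_div ?posrE// (le_trans (ln_le_subr1 _)) ?divr_gt0//.
have -> : a / b - 1 = (a - b) / b by field; rewrite gt_eqF.
by rewrite ler_wpM2l ?subr_ge0// lef_pV2 ?posrE.
Qed.

(** The factor 1/2 is cruder than the sharp 1/4, but it serves only to deduce a finite modified
    log-Sobolev constant from a finite log-Sobolev constant. *)
Lemma sqr_sub_le_ln (R : realType) (a b : R) : 0 < a -> 0 < b ->
  (a - b) ^+ 2 <= 2^-1 * ((a ^+ 2 - b ^+ 2) * (ln (a ^+ 2) - ln (b ^+ 2))).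
Proof.
wlog ba : a b / b <= a => [H a0 b0|a0 b0].
  have [ba|/ltW ab] := leP b a; first exact: H.
  rewrite -sqrrN opprB -[X in 2^-1 * X]mulrNN !opprB; exact: H.
rewrite !lnXn//.
have := ln_ge_1subV (divr_gt0 a0 b0); rewrite ln_div ?posrE// invf_div => h.
have h1 : 0 <= (a ^+ 2 - b ^+ 2) * (ln a - ln b - (1 - b / a)).
  by rewrite mulr_ge0 ?subr_ge0// ler_sqr ?nnegrE ?(ltW a0) ?(ltW b0).
have : 0 <= (a - b) ^+ 2 * (b / a).
  by rewrite mulr_ge0 ?sqr_ge0// divr_ge0// ltW.
have -> : (a - b) ^+ 2 * (b / a) =
  (a ^+ 2 - b ^+ 2) * (1 - b / a) - (a - b) ^+ 2.
  by field; rewrite gt_eqF.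
lra.
Qed.

(** The added mass difference cancels the first-order term at [g = 1], so that a quadratic bound can
    hold. For [g < 1] it follows from [ln_ge_frac] at [1 / g]. *)
Lemma trunc_xln (R : realType) (g : R) : 0 < g ->
  g ^+ 2 * ln (g ^+ 2) - Num.max (g ^+ 2) 1 * ln (Num.max (g ^+ 2) 1) +
  (Num.max (g ^+ 2) 1 - g ^+ 2) <= 2 * (g - 1) ^+ 2.
Proof.
move=> g0; have [g1|g1] := leP 1 g.
  rewrite (max_idPl _) ?exprn_ege1// !subrr addr0.
  by rewrite mulr_ge0// sqr_ge0.
rewrite (max_idPr _) ?expr_le1 ?(ltW g0) ?(ltW g1)// ln1 mulr0 subr0 lnXn//.
have w1 : 1 <= g^-1 by rewrite invf_ge1// ltW.
have := ln_ge_frac w1; rewrite lnV ?posrE// => h.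
have h1 : 0 <= g * ((g^-1 + 1) * - ln g - 2 * (g^-1 - 1)).
  by rewrite mulr_ge0//; lra.
have {}h1 : (1 + g) * ln g <= - 2 * (1 - g).
  rewrite -subr_ge0 (le_trans h1)// le_eqVlt; apply/orP; left; apply/eqP.
  by field; rewrite gt_eqF.
rewrite -(@ler_pM2l R (1 + g)); last lra.
have h2 : 0 <= 2 * g ^+ 2 * (- 2 * (1 - g) - (1 + g) * ln g).
  by rewrite mulr_ge0 ?subr_ge0// mulr_ge0 ?sqr_ge0.
have h3 : 0 <= (1 - g) ^+ 2 * (1 - g) by rewrite mulr_ge0 ?sqr_ge0//; lra.
rewrite -mulr_natl; lra.
Qed.

(** * Entropy and Dirichlet form: linearisation and truncation *)

Section Chain.
Context (R : realType) (X : finType) (Q : X -> X -> R) (pi : X -> R).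
Hypotheses (Qgen : generator Q) (piP : probability_mass pi).
Implicit Types (f g h : X -> R) (x y : X).

Lemma expectD f g :
  expect pi (fun x => f x + g x) = expect pi f + expect pi g.
Proof. by rewrite -big_split; apply: eq_bigr => x _; rewrite mulrDr. Qed.

Lemma expectZ c f : expect pi (fun x => c * f x) = c * expect pi f.
Proof. by rewrite mulr_sumr; apply: eq_bigr => x _; rewrite mulrCA. Qed.

Lemma expectB f g :
  expect pi (fun x => f x - g x) = expect pi f - expect pi g.
Proof. by rewrite -sumrB; apply: eq_bigr => x _; rewrite mulrBr. Qed.

Lemma expect_cst c : expect pi (fun=> c) = c.
Proof. by case: piP => _ s1; rewrite /expect -mulr_suml s1 mul1r. Qed.

Lemma le_expect f g : (forall x, f x <= g x) -> expect pi f <= expect pi g.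
Proof. by case: piP => p0 _ fg; apply: ler_sum => x _; rewrite ler_wpM2l. Qed.

Lemma eq_expect f g : f =1 g -> expect pi f = expect pi g.
Proof. by move=> fg; apply: eq_bigr => x _; rewrite fg. Qed.

Lemma expect_ge0 f : (forall x, 0 <= f x) -> 0 <= expect pi f.
Proof. by move=> f0; rewrite -[leLHS](expect_cst 0); exact: le_expect. Qed.

Lemma expect_gt0 f : (forall x, 0 < f x) -> 0 < expect pi f.
Proof.
case: piP => p0 s1 f0; rewrite lt_neqAle expect_ge0 ?andbT; last first.
  by move=> x; exact: ltW.
apply/eqP => /esym/eqP; rewrite psumr_eq0; last first.
  by move=> x _; rewrite mulr_ge0// ltW.
move=> /allP h; move: s1; rewrite big1 => [/esym/eqP|x _].
  by rewrite oner_eq0.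
by apply/eqP; have := h x (mem_index_enum x);
  rewrite mulf_eq0 (gt_eqF (f0 x)) orbF.
Qed.

(** Discriminant of the nonnegative quadratic form [E (s f - r g)^2]; if both second moments vanish,
    [s = 1] and [r = 1, -1] force [c = 0]. *)
Lemma expect_cauchy_schwarz f g :
  expect pi (fun x => f x * g x) ^+ 2 <=
  expect pi (fun x => f x ^+ 2) * expect pi (fun x => g x ^+ 2).
Proof.
set a := expect _ (fun x => f x ^+ 2); set b := expect _ (fun x => g x ^+ 2).
set c := expect _ _.
have key s r : 0 <= s ^+ 2 * a - 2 * (s * r) * c + r ^+ 2 * b.
  rewrite /a /b /c -!expectZ -expectB -expectD; apply: expect_ge0 => x.
  have -> : s ^+ 2 * f x ^+ 2 - 2 * (s * r) * (f x * g x) + r ^+ 2 * g x ^+ 2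
    = (s * f x - r * g x) ^+ 2 by ring.
  exact: sqr_ge0.
have a0 : 0 <= a by apply: expect_ge0 => x; exact: sqr_ge0.
have b0 : 0 <= b by apply: expect_ge0 => x; exact: sqr_ge0.
have [a_eq0|ane0] := eqVneq a 0; last first.
  have -> : c ^+ 2 <= a * b = (0 <= a * (a * b - c ^+ 2)).
    by rewrite pmulr_rge0 ?subr_ge0// lt_neqAle eq_sym ane0.
  by apply: le_trans (key c a) _; rewrite le_eqVlt; apply/orP; left;
    apply/eqP; ring.
have [b_eq0|bne0] := eqVneq b 0; last first.
  have -> : c ^+ 2 <= a * b = (0 <= b * (a * b - c ^+ 2)).
    by rewrite pmulr_rge0 ?subr_ge0// lt_neqAle eq_sym bne0.
  by apply: le_trans (key b c) _; rewrite le_eqVlt; apply/orP; left;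
    apply/eqP; ring.
have := key 1 1; have := key 1 (-1); rewrite a_eq0 b_eq0 => h1 h2.
have -> : c = 0 by lra.
by rewrite mul0r expr0n.
Qed.

Lemma entropyE1 f : expect pi f = 1 ->
  entropy pi f = expect pi (fun x => f x * ln (f x)).
Proof. by move=> f1; rewrite /entropy f1 ln1 mulr0 subr0. Qed.

(** Integrate the tangent-line bound [f ln (f / c) >= f - c], whose right side has expectation 0. *)
Lemma entropy_ge0 f : (forall x, 0 < f x) -> 0 <= entropy pi f.
Proof.
move=> f0; rewrite /entropy; set c := expect pi f.
have c0 : 0 < c by exact: expect_gt0.
have : expect pi (fun x => ln c * f x + (f x - c)) <=
    expect pi (fun x => f x * ln (f x)).
  apply: le_expect => x; have fx0 := f0 x.
  have := ln_ge_1subV (divr_gt0 fx0 c0); rewrite ln_div ?posrE// invf_div => h.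
  have : 0 <= f x * (ln (f x) - ln c - (1 - c / f x)).
    by rewrite mulr_ge0 ?subr_ge0// ltW.
  have -> : f x * (ln (f x) - ln c - (1 - c / f x)) =
    f x * ln (f x) - (ln c * f x + (f x - c)) by field; rewrite gt_eqF.
  by rewrite subr_ge0.
rewrite expectD (expectZ _ f) expectB expect_cst -/c; lra.
Qed.

Lemma entropyZ c f : 0 < c -> (forall x, 0 < f x) ->
  entropy pi (fun x => c * f x) = c * entropy pi f.
Proof.
move=> c0 f0; have e0 := expect_gt0 f0.
rewrite /entropy expectZ lnM ?posrE//.
rewrite (@eq_expect _ (fun x => c * (f x * ln (f x)) + c * ln c * f x)).
  by rewrite expectD !expectZ; ring.
by move=> x; rewrite lnM ?posrE//; ring.
Qed.

Lemma dirichlet_le c f g f' g' :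
  (forall x y, allowed Q x y -> (f x - f y) * (g x - g y) <=
     c * ((f' x - f' y) * (g' x - g' y))) ->
  dirichlet Q pi f g <= c * dirichlet Q pi f' g'.
Proof.
case: Qgen piP => Q0 _ [p0 _] H.
rewrite /dirichlet mulrCA ler_wpM2l ?invr_ge0//.
rewrite mulr_sumr; apply: ler_sum => x _.
rewrite mulr_sumr; apply: ler_sum => y _.
(* Diagonal terms vanish whatever the sign of [Q x x]; the remaining weights are nonnegative. *)
have [->|xy] := eqVneq x y; first by rewrite !subrr !mulr0.
rewrite -!mulrA [leRHS]mulrCA ler_wpM2l// [leRHS]mulrCA.
have := Q0 _ _ xy; rewrite le_eqVlt => /predU1P[<-|Qxy].
  by rewrite !mul0r.
by rewrite ler_pM2l//; exact: H.
Qed.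

Lemma dirichlet_ge0 f g :
  (forall x y, allowed Q x y -> 0 <= (f x - f y) * (g x - g y)) ->
  0 <= dirichlet Q pi f g.
Proof.
move=> H; rewrite -[leRHS]mul1r.
have <- : dirichlet Q pi (fun=> 0) (fun=> 0) = 0.
  rewrite /dirichlet big1 ?mulr0// => x _.
  by rewrite big1// => y _; rewrite subrr mulr0.
by apply: dirichlet_le => x y /H; rewrite !subrr mul0r mul1r.
Qed.

Lemma dirichlet_sqr_ge0 g : 0 <= dirichlet Q pi g g.
Proof. by apply: dirichlet_ge0 => x y _; rewrite -expr2 sqr_ge0. Qed.

Lemma dirichlet_gt0 f g x y : 0 < pi x -> allowed Q x y ->
  (forall u v, allowed Q u v -> 0 <= (f u - f v) * (g u - g v)) ->
  0 < (f x - f y) * (g x - g y) -> 0 < dirichlet Q pi f g.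
Proof.
case: Qgen piP => Q0 _ [p0 _] px Qxy H fg0.
have t0 u v : 0 <= pi u * Q u v * (f u - f v) * (g u - g v).
  have [->|uv] := eqVneq u v; first by rewrite !subrr !mulr0.
  rewrite -!mulrA mulr_ge0//.
  have := Q0 _ _ uv; rewrite le_eqVlt => /predU1P[<-|Quv].
    by rewrite !mul0r.
  by rewrite pmulr_rge0//; exact: H.
rewrite /dirichlet pmulr_rgt0 ?invr_gt0//.
rewrite (bigD1 x)//= (bigD1 y)//= -addrA ltr_wpDr//.
  rewrite addr_ge0// ?sumr_ge0// => u _.
  by rewrite sumr_ge0.
by rewrite -!mulrA mulrA pmulr_rgt0// mulr_gt0.
Qed.

(* Linearise the inequality at the constants: apply it to [1 + e (h - E h)]
   for small [e]. *)
Lemma MLS_poincare t h : MLS_constants Q pi t -> 0 <= t ->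
  expect pi (fun x => h x ^+ 2) - expect pi h ^+ 2 <=
  2 * t * dirichlet Q pi h h.
Proof.
move=> tM t0; set D := dirichlet _ _ _ _; set m := expect pi h.
pose k x := h x - m.
have Ek : expect pi k = 0 by rewrite expectB expect_cst subrr.
have -> : expect pi (fun x => h x ^+ 2) - m ^+ 2 =
  expect pi (fun x => k x ^+ 2).
  rewrite [RHS](@eq_expect _ (fun x => h x ^+ 2 - m ^+ 2 - 2 * m * k x));
    last first.
    by move=> x; rewrite /k; ring.
  by rewrite !expectB expectZ Ek expect_cst mulr0 subr0.
set V := expect _ _; have D0 : 0 <= D by exact: dirichlet_sqr_ge0.
pose M := \sum_x `|k x| + 1.
have kM x : `|k x| <= M.
  by rewrite /M (bigD1 x)//= -addrA lerDl addr_ge0// sumr_ge0.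
have M0 : 0 < M by rewrite ltr_wpDl// sumr_ge0.
have key d : 0 < d < 1 -> V * (1 - d) <= 2 * t * D * (1 + d).
  move=> /andP[d0 d1]; pose e := d / M; have e0 : 0 < e by rewrite divr_gt0.
  have ek x : - d <= e * k x <= d.
    rewrite -ler_norml normrM gtr0_norm// /e mulrAC ler_pdivrMr//.
    by rewrite ler_wpM2l// ltW.
  clearbody e.
  pose f x := 1 + e * k x.
  have f_ge x : 1 - d <= f x by have := ek x; rewrite /f; lra.
  have f0 x : 0 < f x by have := f_ge x; lra.
  have Ef : expect pi f = 1.
    by rewrite expectD expect_cst expectZ Ek mulr0 addr0.
  have := tM f f0; rewrite entropyE1// => h1.
  have h2 : e ^+ 2 / (2 * (1 + d)) * V <= expect pi (fun x => f x * ln (f x)).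
    (* Since [k] has expectation 0, the linear term [e * k] may be subtracted before comparing
       pointwise. *)
    rewrite -expectZ -[leRHS]subr0 -(mulr0 e) -Ek -expectZ -expectB.
    apply: le_expect => x; apply: le_trans (xln_quad _ (ek x));
      last by rewrite d0.
    by rewrite le_eqVlt; apply/orP; left; apply/eqP; rewrite exprMn; ring.
  have h3 : dirichlet Q pi f (@ln R \o f) <= e ^+ 2 / (1 - d) * D.
    apply: dirichlet_le => x y _ /=.
    have d1' : 0 < 1 - d by lra.
    apply: le_trans (sub_ln_le d1' (f_ge x) (f_ge y)) _.
    rewrite le_eqVlt; apply/orP; left; apply/eqP.
    by rewrite /f /k; ring.
  have h4 : e ^+ 2 / (2 * (1 + d)) * V <= t * (e ^+ 2 / (1 - d) * D).
    apply: le_trans h2 (le_trans h1 _); rewrite ler_wpM2l//.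
  have c0 : 0 < e ^+ 2 / (2 * (1 + d) * (1 - d)).
    by rewrite divr_gt0 ?exprn_gt0// !mulr_gt0//; lra.
  rewrite -(ler_pM2l c0); apply: le_trans (le_trans _ h4) _.
    by rewrite le_eqVlt; apply/orP; left; apply/eqP; field; apply/andP; split;
      rewrite gt_eqF//; lra.
  by rewrite le_eqVlt; apply/orP; left; apply/eqP; field; apply/andP; split;
      rewrite gt_eqF//; lra.
(* If [W < V], then [key] gives [V - W <= d (V + W)] for every [d] in (0, 1); the [d] chosen makes
   the right side [(V - W) / 2]. *)
rewrite leNgt; apply/negP; set W := 2 * t * D => WV.
have W0 : 0 <= W by apply: mulr_ge0 => //; apply: mulr_ge0.
have VW0 : 0 < 2 * (V + W) by lra.
have := key ((V - W) / (2 * (V + W))); rewrite divr_gt0//=; last lra.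
rewrite ltr_pdivrMr// mul1r => /(_ ltac:(lra)).
rewrite -/W; set d := _ / _ => hd.
have : d * (V + W) = (V - W) / 2 by rewrite /d; field; rewrite gt_eqF//; lra.
lra.
Qed.

(* With [F = max(g ^ 2, 1)], the excess mass [E F - 1] equals
   [E |g ^ 2 - 1| / 2], so by Cauchy-Schwarz its square is at most [Var g]. *)
Lemma entropy_trunc g : (forall x, 0 < g x) ->
  expect pi (fun x => g x ^+ 2) = 1 ->
  entropy pi (fun x => g x ^+ 2) <=
  entropy pi (fun x => Num.max (g x ^+ 2) 1) + 9 / 2 * (1 - expect pi g ^+ 2).
Proof.
move=> g0 g1; set m := expect pi g.
have m0 : 0 < m by exact: expect_gt0.
pose F x := Num.max (g x ^+ 2) 1.
pose d := expect pi F - 1.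
have d0 : 0 <= d.
  by rewrite subr_ge0 -[leLHS](expect_cst 1); apply: le_expect => x;
    rewrite le_max lexx orbT.
have Eg1 : expect pi (fun x => (g x - 1) ^+ 2) = 2 - 2 * m.
  rewrite (@eq_expect _ (fun x => g x ^+ 2 - 2 * g x + 1)).
    by rewrite expectD expectB (expectZ _ g) g1 expect_cst -/m; ring.
  by move=> x; ring.
have Eg2 : expect pi (fun x => (g x + 1) ^+ 2) = 2 + 2 * m.
  rewrite (@eq_expect _ (fun x => g x ^+ 2 + 2 * g x + 1)).
    by rewrite !expectD (expectZ _ g) g1 expect_cst -/m; ring.
  by move=> x; ring.
have d2 : d ^+ 2 <= 1 - m ^+ 2.
  have dE : 2 * d = expect pi (fun x => `|g x - 1| * (g x + 1)).
    rewrite [RHS](@eq_expect _ (fun x => 2 * F x - g x ^+ 2 - 1)).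
      by rewrite !expectB (expectZ _ F) g1 expect_cst /d; ring.
    move=> x; rewrite /F.
    have [gx1|gx1] := leP 1 (g x).
      rewrite (max_idPl _) ?exprn_ege1// ger0_norm ?subr_ge0//; ring.
    rewrite (max_idPr _) ?expr_le1 ?(ltW gx1) ?(ltW (g0 x))//.
    rewrite ltr0_norm ?subr_lt0//; ring.
  have := expect_cauchy_schwarz (fun x => `|g x - 1|) (fun x => g x + 1).
  rewrite -dE Eg2 (@eq_expect _ (fun x => (g x - 1) ^+ 2)) ?Eg1; last first.
    by move=> x; rewrite real_normK// num_real.
  lra.
(* The constant 9/2 is 1/2 + 4: the changed mean costs at most [d^2 / 2 <= (1 - m^2) / 2], and
   [trunc_xln] costs [4 (1 - m) <= 4 (1 - m^2)]. *)
have dln : 2 * ((1 + d) * ln (1 + d)) <= (1 + d) ^+ 2 - 1.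
  by apply: xln_le_half; lra.
have EF : expect pi F = 1 + d by rewrite /d; ring.
rewrite entropyE1// /entropy -/F EF.
have : expect pi (fun x => g x ^+ 2 * ln (g x ^+ 2) - F x * ln (F x) +
    (F x - g x ^+ 2)) <= expect pi (fun x => 2 * (g x - 1) ^+ 2).
  by apply: le_expect => x; exact: trunc_xln.
rewrite expectD !expectB expectZ Eg1 EF g1.
have m2 : m ^+ 2 <= 1 by have := sqr_ge0 d; lra.
have m1 : m <= 1 by rewrite -(@expr_le1 _ 2)// ltW.
have : 0 <= m * (1 - m) by rewrite mulr_ge0//; lra.
have -> : expect pi (fun x => Num.max (g x ^+ 2) 1 *
    ln (Num.max (g x ^+ 2) 1)) =
  expect pi (fun x => F x * ln (F x)) by [].
lra.
Qed.

(** The truncation contributes [t * reg_cost k] through [trunc_edge], and its loss contributes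
    [9/2 * 2 t] through [MLS_poincare]. *)
Lemma MLS_entropy_regular t k g : MLS_constants Q pi t -> 0 <= t -> 1 < k ->
  (forall x, 0 < g x) -> expect pi (fun x => g x ^+ 2) = 1 ->
  (forall x y, allowed Q x y -> g y <= k * Num.max (g x) 1) ->
  (forall x y, allowed Q x y -> allowed Q y x) ->
  entropy pi (fun x => g x ^+ 2) <=
  t * (reg_cost k + 9) * dirichlet Q pi g g.
Proof.
move=> tM t0 k1 g0 g1 reg sym.
have h1 := entropy_trunc g0 g1.
have h2 := MLS_poincare g tM t0; rewrite g1 in h2.
have h3 := tM (fun x => Num.max (g x ^+ 2) 1).
have h4 : dirichlet Q pi (fun x => Num.max (g x ^+ 2) 1)
   (@ln R \o (fun x => Num.max (g x ^+ 2) 1)) <=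
   reg_cost k * dirichlet Q pi g g.
  apply: dirichlet_le => x y Qxy /=; rewrite -expr2.
  by apply: trunc_edge => //; apply: reg => //; exact: sym.
have := ler_wpM2l t0 h4 => h5.
apply: (le_trans h1).
apply: le_trans (lerD (le_trans (h3 _) h5) (ler_wpM2l _ h2)) _.
- by move=> x; rewrite lt_max ltr01 orbT.
- lra.
- lra.
Qed.

End Chain.

(** * Changing a function at a single state *)

Section Reversible.
Context (R : realType) (X : finType) (Q : X -> X -> R) (pi : X -> R).
Hypotheses (Qgen : generator Q) (piP : probability_mass pi).
Hypothesis Qrev : reversible Q pi.
Implicit Types (f g h : X -> R) (x y : X).

Definition update g x b : X -> R := fun z => if z == x then b else g z.

(** Only the row and the column of [x] change; by reversibility they change equally, which cancels
    the factor 1/2. *)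
Lemma dirichlet_update g x b :
  dirichlet Q pi (update g x b) (update g x b) = dirichlet Q pi g g +
  pi x * \sum_(z | z != x) Q x z * ((b - g z) ^+ 2 - (g x - g z) ^+ 2).
Proof.
set g' := update g x b.
pose D u v := pi u * Q u v * ((g' u - g' v) ^+ 2 - (g u - g v) ^+ 2).
have D0 u v : u != x -> v != x -> D u v = 0.
  by move=> /negPf ux /negPf vx; rewrite /D /g' /update ux vx subrr mulr0.
have Dxx : D x x = 0 by rewrite /D !subrr mulr0.
have Dsym u v : D u v = D v u.
  by rewrite /D Qrev -(sqrrN (g' u - g' v)) -(sqrrN (g u - g v)) !opprB.
have DE v : v != x ->
    D x v = pi x * (Q x v * ((b - g v) ^+ 2 - (g x - g v) ^+ 2)).
  by move=> /negPf vx; rewrite /D /g' /update eqxx vx mulrA.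
apply/eqP; rewrite addrC -subr_eq; apply/eqP.
rewrite mulr_sumr -(eq_bigr _ DE).
rewrite /dirichlet -mulrBr -sumrB.
transitivity (2^-1 * \sum_u \sum_v D u v).
  congr (_ * _); apply: eq_bigr => u _; rewrite -sumrB; apply: eq_bigr => v _.
  by rewrite /D; ring.
have S1 : \sum_v D x v = \sum_(v | v != x) D x v.
  by rewrite (bigD1 x)//= Dxx add0r.
have S2 : \sum_(u | u != x) \sum_v D u v = \sum_(v | v != x) D x v.
  apply: eq_bigr => u ux; rewrite (bigD1 x)//= big1 ?addr0//.
  by move=> v vx; exact: D0.
by rewrite (bigD1 x)//= S1 S2; field.
Qed.

Lemma expect_update (F : R -> R) g x b :
  expect pi (fun z => F (update g x b z)) =
  expect pi (fun z => F (g z)) + pi x * (F b - F (g x)).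
Proof.
rewrite /expect (bigD1 x)//= [X in _ = X + _](bigD1 x)//= /update eqxx.
rewrite (@eq_bigr _ _ _ _ _ (fun z => z != x) _ (fun z => pi z * F (g z))).
  ring.
by move=> z /negPf ->.
Qed.

(** Let [s] be the new mass at [x]. The factor 2 makes [E f ln f] grow by at least [2 s ln 2], while
    the mean rises to at most [1 + s], which costs at most [(1 + s) ln (1 + s) <= 2 s ln 2] because
    [s <= 1]. *)
Lemma entropy_raise g x :
  (forall z, 0 < g z) -> expect pi (fun z => g z ^+ 2) = 1 ->
  pi x * (2 * Num.max (g x) 1) ^+ 2 <= 1 ->
  entropy pi (fun z => g z ^+ 2) <=
  entropy pi (fun z => update g x (2 * Num.max (g x) 1) z ^+ 2).
Proof.
case: piP => p0 _ g0 g1; set A := Num.max (g x) 1 => sle1.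
have A1 : 1 <= A by rewrite le_max lexx orbT.
have gxA : g x ^+ 2 <= A ^+ 2.
  by rewrite ler_sqr ?nnegrE ?le_max ?lexx// ltW//; lra.
rewrite entropyE1// /entropy.
rewrite (expect_update (fun r => r ^+ 2)).
rewrite (expect_update (fun r => r ^+ 2 * ln (r ^+ 2))).
rewrite g1; set s := pi x * (2 * A) ^+ 2 in sle1 *.
have A21 : 1 <= A ^+ 2 by rewrite exprn_ege1.
have s0 : 0 <= s by rewrite mulr_ge0// sqr_ge0.
have h1 : pi x * ((2 * A) ^+ 2 - g x ^+ 2) <= s.
  by rewrite ler_wpM2l// gerDl oppr_le0 sqr_ge0.
have h0 : 0 <= pi x * ((2 * A) ^+ 2 - g x ^+ 2).
  by rewrite mulr_ge0// exprMn; lra.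
have h2 := @xln_mono R (1 + pi x * ((2 * A) ^+ 2 - g x ^+ 2)) (1 + s)
  ltac:(lra) ltac:(lra).
have h3 := @xln_chord R s ltac:(lra).
have h4 : g x ^+ 2 * ln (g x ^+ 2) <= A ^+ 2 * ln (A ^+ 2).
  have [gx1|gx1] := leP 1 (g x).
    by apply: xln_mono => //; rewrite exprn_ege1.
  apply: (@le_trans _ _ 0).
    by rewrite mulr_ge0_le0 ?sqr_ge0// ln_le0// expr_le1// ltW.
  by rewrite mulr_ge0 ?sqr_ge0 ?ln_ge0.
have h5 : ln ((2 * A) ^+ 2) = 2 * ln 2 + ln (A ^+ 2).
  rewrite exprMn lnM ?posrE ?exprn_gt0//; last lra.
  by rewrite lnXn//; ring.
have h6 : s * (2 * ln 2) <= pi x * ((2 * A) ^+ 2 * ln ((2 * A) ^+ 2) -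
    g x ^+ 2 * ln (g x ^+ 2)).
  rewrite /s -mulrA ler_wpM2l// h5.
  have : 0 <= A ^+ 2 * ln (A ^+ 2) by rewrite mulr_ge0 ?sqr_ge0 ?ln_ge0.
  rewrite exprMn; lra.
lra.
Qed.

(** The edge to [y] alone makes the mean of [g] over the jumps from [x] at least [2 A]. The energy
    change is [2 A - g x >= 1] times a quantity at most [(g x - 2 A)] times the jump rate. *)
Lemma dirichlet_raise p g x y : 0 < p -> p * jump_rate Q x <= Q x y ->
  x != y -> (forall z, 0 < g z) -> 2 / p * Num.max (g x) 1 < g y ->
  dirichlet Q pi (update g x (2 * Num.max (g x) 1))
    (update g x (2 * Num.max (g x) 1)) <=
  dirichlet Q pi g g - pi x * jump_rate Q x.
Proof.
case: Qgen piP => Q0 _ [pi0 _] p0 pQ xy g0; set A := Num.max (g x) 1 => gy.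
have A1 : 1 <= A by rewrite le_max lexx orbT.
have gA : g x <= A by rewrite le_max lexx.
have J0 : 0 <= jump_rate Q x.
  by apply: sumr_ge0 => z zx; rewrite Q0// eq_sym.
rewrite dirichlet_update lerD2l -mulrN ler_wpM2l//.
have -> : \sum_(z | z != x) Q x z * ((2 * A - g z) ^+ 2 - (g x - g z) ^+ 2) =
  (2 * A - g x) * ((2 * A + g x) * jump_rate Q x -
                   2 * \sum_(z | z != x) Q x z * g z).
  rewrite /jump_rate mulrBr !mulr_sumr -sumrB.
  by apply: eq_bigr => z _; ring.
have h1 : 2 * A * jump_rate Q x <= \sum_(z | z != x) Q x z * g z.
  rewrite (bigD1 y) 1?eq_sym//= -[leLHS]addr0 lerD//; last first.
    apply: sumr_ge0 => z /andP[zx _]; rewrite mulr_ge0 ?Q0 1?eq_sym//.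
    by rewrite ltW.
  have -> : 2 * A * jump_rate Q x = p * jump_rate Q x * (2 / p * A).
    by field; rewrite gt_eqF.
  have A0 : 0 <= A by lra.
  apply: ler_pM (ltW gy) => //; first by rewrite mulr_ge0// ltW.
  by rewrite mulr_ge0// divr_ge0// ltW.
have h2 : (2 * A + g x) * jump_rate Q x -
    2 * \sum_(z | z != x) Q x z * g z <= - jump_rate Q x.
  have : (g x) * jump_rate Q x <= A * jump_rate Q x by rewrite ler_wpM2r.
  have : 1 * jump_rate Q x <= A * jump_rate Q x by rewrite ler_wpM2r.
  lra.
have h3 : 1 <= 2 * A - g x by lra.
apply: (le_trans (ler_wpM2l (le_trans ler01 h3) h2)).
by rewrite mulrN lerN2 ler_peMl.
Qed.

(** Normalisation forces [g x ^+ 2 <= 1 / pi x]. The added 1 makes the bound positive. *)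
Lemma dirichlet_bounded : (forall x, 0 < pi x) ->
  exists2 M, 0 < M & forall g, (forall x, 0 < g x) ->
    expect pi (fun x => g x ^+ 2) = 1 -> dirichlet Q pi g g <= M.
Proof.
move=> pi0; pose B := \sum_x (pi x)^-1.
have B0 : 0 <= B by apply: sumr_ge0 => x _; rewrite invr_ge0 ltW.
exists (2^-1 * (\sum_x \sum_y `|pi x * Q x y| * (2 * B)) + 1).
  rewrite ltr_wpDl// mulr_ge0 ?invr_ge0//.
  by apply: sumr_ge0 => x _; apply: sumr_ge0 => y _; rewrite !mulr_ge0.
move=> g g0 g1; rewrite -[leLHS]addr0 lerD// ler_wpM2l ?invr_ge0//.
have gB x : g x ^+ 2 <= B.
  apply: (@le_trans _ _ (pi x)^-1); last first.
    rewrite /B (bigD1 x)//= lerDl sumr_ge0// => y _.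
    by rewrite invr_ge0 ltW.
  rewrite -[leRHS]mulr1 ler_pdivlMl// -g1 /expect (bigD1 x)//= lerDl.
  by rewrite sumr_ge0// => y _; rewrite mulr_ge0 ?sqr_ge0// ltW.
apply: ler_sum => x _; apply: ler_sum => y _; rewrite -mulrA -expr2.
apply: le_trans (ler_norm _) _; rewrite normrM ler_wpM2l//.
rewrite ger0_norm ?sqr_ge0//.
have := gB x; have := gB y; have : 0 <= g x * g y by rewrite mulr_ge0 ?ltW.
lra.
Qed.

End Reversible.

(** * Consequences of irreducibility and bounds from the sparsity parameter *)

Lemma connect_stable (X : finType) (e : rel X) (P : X -> Prop) x y :
  (forall u v, e u v -> P u -> P v) -> connect e x y -> P x -> P y.
Proof.
move=> eP /connectP[s]; elim: s x => [|z s IH] x /= => [_ -> //|].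
by move=> /andP[xz zs] yE Px; apply: (IH z) => //; exact: eP xz Px.
Qed.

Section Irreducible.
Context (R : realType) (X : finType) (Q : X -> X -> R) (pi : X -> R).
Hypotheses (Qgen : generator Q) (Qirr : irreducible Q).
Hypotheses (piP : probability_mass pi) (Qrev : reversible Q pi).

Lemma allowed_neq x y : allowed Q x y -> x != y.
Proof.
case: Qgen => Q0 Qs; rewrite /allowed; apply: contraTneq => <-.
rewrite -leNgt; have := Qs x; rewrite (bigD1 x)//= => /eqP.
rewrite addr_eq0 => /eqP ->; rewrite oppr_le0 sumr_ge0// => z zx.
by rewrite Q0// eq_sym.
Qed.

(** Some state has positive mass, and detailed balance propagates positivity along allowed
    transitions. *)
Lemma stationary_gt0 x : 0 < pi x.
Proof.
case: piP => p0 s1; case: Qgen => Q0 _.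
have [x0 px0] : exists x0, 0 < pi x0.
  apply: contrapT => /forallNP H; move: s1; rewrite big1 => [/esym/eqP|y _].
    by rewrite oner_eq0.
  by apply/eqP; rewrite eq_le p0 andbT leNgt; apply/negP; exact: H.
apply: (connect_stable (P := fun x => 0 < pi x) _ (Qirr x0 x) px0).
move=> u v Quv pu.
have : 0 < pi v * Q v u by rewrite -Qrev mulr_gt0.
by move: (p0 v); rewrite le_eqVlt => /predU1P[<-|//]; rewrite mul0r ltxx.
Qed.

Lemma allowed_sym x y : allowed Q x y -> allowed Q y x.
Proof.
move=> Qxy; have : 0 < pi y * Q y x by rewrite -Qrev mulr_gt0// stationary_gt0.
by rewrite pmulr_rgt0// stationary_gt0.
Qed.

Lemma jump_rate_ge (x : X) (P : pred X) : (forall y, P y -> y != x) ->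
  \sum_(y | P y) Q x y <= jump_rate Q x.
Proof.
case: Qgen => Q0 _ Px; rewrite /jump_rate big_mkcond [leRHS]big_mkcond.
apply: ler_sum => y _; case: ifPn => [/Px -> //|_].
by case: ifPn => // yx; rewrite Q0// eq_sym.
Qed.

Lemma jump_rate_ge1 x y : allowed Q x y -> Q x y <= jump_rate Q x.
Proof.
move=> /allowed_neq xy; have := @jump_rate_ge x (pred1 y).
rewrite big_pred1_eq; apply => z /eqP ->.
by rewrite eq_sym.
Qed.

Let p := sparsity Q.

Lemma sparsity_max_le x y : allowed Q x y ->
  p * Num.max (jump_rate Q x) (Q y x) <= Q x y.
Proof.
move=> Qxy; have Qyx : 0 < Q y x := allowed_sym Qxy.
have J0 : 0 < Num.max (jump_rate Q x) (Q y x) by rewrite lt_max Qyx orbT.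
rewrite -ler_pdivlMr//.
exact: (@bigmin_le_cond _ R _ 1 (x, y) (fun e => allowed Q e.1 e.2)
  (fun e => Q e.1 e.2 / Num.max (jump_rate Q e.1) (Q e.2 e.1))).
Qed.

Lemma sparsity_gt0 : 0 < p.
Proof.
apply: lt_bigmin => // -[x y] /= Qxy; have Qyx : 0 < Q y x := allowed_sym Qxy.
by rewrite divr_gt0// lt_max Qyx orbT.
Qed.

Lemma sparsity_jump_le x y : allowed Q x y -> p * jump_rate Q x <= Q x y.
Proof.
move=> /sparsity_max_le; apply: le_trans.
by rewrite ler_wpM2l ?le_max ?lexx// ltW// sparsity_gt0.
Qed.

(** The term [Q y x] in the maximum gives [p * Q y x <= Q x y]; detailed balance turns this into a
    comparison of masses. *)
Lemma sparsity_stationary_le x y : allowed Q x y -> p * pi x <= pi y.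
Proof.
move=> Qxy; have Qyx : 0 < Q y x := allowed_sym Qxy.
rewrite -(ler_pM2r Qyx) -Qrev mulrAC [leRHS]mulrC.
rewrite ler_wpM2r ?(ltW (stationary_gt0 x))//.
apply: le_trans (sparsity_max_le Qxy).
by rewrite ler_wpM2l ?le_max ?lexx ?orbT// ltW// sparsity_gt0.
Qed.

Lemma exists_neighbour x : (1 < #|X|)%N -> exists y, allowed Q x y.
Proof.
move=> X2; apply: contrapT => /forallNP H.
have H1 z : z = x.
  apply: (connect_stable (P := fun z => z = x) _ (Qirr x z)) => // u v uv ux.
  by case: (H v); rewrite -ux.
by move: X2; rewrite ltnNge => /negP; apply; apply/fintype_le1P => a b;
  rewrite /= (H1 a) (H1 b).
Qed.

(** Some state has two neighbours, and the two rates share its jump rate. Otherwise each state would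
    have a unique neighbour, and a pair of neighbours would exhaust the space. *)
Lemma sparsity_le_half : (2 < #|X|)%N -> p <= 1 / 2.
Proof.
move=> X3; have X2 : (1 < #|X|)%N by exact: ltnW.
have [x [y [z [xy xz yz]]]] :
    exists x y z, [/\ allowed Q x y, allowed Q x z & y != z].
  apply: contrapT => H.
  have uniq x y z : allowed Q x y -> allowed Q x z -> y = z.
    by move=> xy xz; apply: contrapT => /eqP yz; apply: H; exists x, y, z.
  have /card_gt0P[x _] : (0 < #|X|)%N by exact: ltnW.
  have [y xy] := exists_neighbour x X2.
  have H1 z : z \in [:: x; y].
    apply: (connect_stable (P := fun z => z \in [:: x; y]) _ (Qirr x z))
      => [u v uv|].
      rewrite !inE => /orP[/eqP uE|/eqP uE]; rewrite uE in uv.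
        by rewrite (uniq _ _ _ uv xy) eqxx orbT.
      by rewrite (uniq _ _ _ uv (allowed_sym xy)) eqxx.
    by rewrite !inE eqxx.
  have := card_size [:: x; y]; have -> : #|[:: x; y]| = #|X|.
    by apply: eq_card => z; rewrite H1.
  by rewrite leqNgt X3.
have h : Q x y + Q x z <= jump_rate Q x.
  have := @jump_rate_ge x (pred2 y z).
  rewrite (bigD1 y)/= ?eqxx// (big_pred1 z) => [|u]; last first.
    rewrite andb_orl andbN /=; have [->/=|//] := eqVneq u z.
    by rewrite eq_sym yz.
  by apply=> u /orP[] /eqP ->; rewrite eq_sym allowed_neq.
have := sparsity_jump_le xy; have := sparsity_jump_le xz => h1 h2.
have J0 : 0 < jump_rate Q x.
  by apply: lt_le_trans h; rewrite addr_gt0.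
rewrite ler_pdivlMr// -(ler_pM2r J0); lra.
Qed.

(** A test function that singles out one state has nonnegative entropy and positive
    [dirichlet Q pi f (ln f)]. *)
Lemma MLS_constant_ge0 t : (1 < #|X|)%N -> MLS_constants Q pi t -> 0 <= t.
Proof.
move=> X2 tM; have /card_gt0P[x _] : (0 < #|X|)%N by exact: ltnW.
have [y xy] := exists_neighbour x X2.
pose f (z : X) : R := if z == x then 2 else 1.
have f0 z : 0 < f z by rewrite /f; case: ifP.
have l2 := @ln2_ge R.
have D0 : 0 < dirichlet Q pi f (@ln R \o f).
  apply: (dirichlet_gt0 Qgen piP (stationary_gt0 x) xy) => [u v _|].
    by rewrite /f /=; case: ifP; case: ifP; rewrite ?ln1 ?subrr ?mul0r//; lra.
  rewrite /f /= eqxx eq_sym (negPf (allowed_neq xy)) ln1; lra.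
have := le_trans (entropy_ge0 piP f0) (tM f f0).
by rewrite pmulr_lge0.
Qed.

End Irreducible.

(** * Comparison of the two constants *)

Lemma reg_cost_sparse (R : realType) (p : R) : 0 < p -> p <= 1 / 2 ->
  reg_cost (2 / p) + 9 <= 20 * ln (1 / p).
Proof.
move=> p0 p2; have k4 : 4 <= 2 / p by rewrite ler_pdivlMr//; lra.
(* From [k >= 4], [2 (k + 1) / (k - 1) <= 10/3]; from [p <= 1 / 2], [ln (2 / p) <= 2 ln (1 / p)].
   What remains is [9 <= 40/3 ln (1 / p)], true already at [ln 2]. *)
have l2 := @ln2_ge R.
have lp : ln 2 <= ln (1 / p).
  by rewrite ler_ln ?posrE ?divr_gt0// ler_pdivlMr//; lra.
have kE : ln (2 / p) = ln 2 + ln (1 / p).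
  by rewrite !ln_div ?posrE// ln1; ring.
have : reg_cost (2 / p) <= 10 / 3 * ln (2 / p).
  rewrite /reg_cost ler_wpM2r ?ln_ge0//; first lra.
  by rewrite ler_pdivrMr; lra.
lra.
Qed.

Section Main.
Context (R : realType) (X : finType) (Q : X -> X -> R) (pi : X -> R).
Hypotheses (Qgen : generator Q) (Qirr : irreducible Q).
Hypotheses (piP : probability_mass pi) (Qrev : reversible Q pi).

Let p := sparsity Q.

Lemma LS_constants_single : (#|X| <= 1)%N ->
  LS_constants Q pi = setT /\ MLS_constants Q pi = setT.
Proof.
move=> /fintype_le1P X1.
have E0 f (t : R) : entropy pi f <= t * 0.
  rewrite mulr0.
  have [x _|X0] := pickP X; last first.
    by case: piP => _; rewrite big_pred0// => /eqP; rewrite eq_sym oner_eq0.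
  rewrite /entropy (@eq_expect _ _ _ f (fun=> f x)) => [|y];
    last by rewrite (X1 x y : y = x).
  rewrite (@eq_expect _ _ _ (fun y => f y * ln (f y)) (fun=> f x * ln (f x)))
    => [|y].
    by rewrite !(expect_cst piP) subrr.
  by rewrite (X1 x y : y = x).
have D0 f g : dirichlet Q pi f g = 0.
  rewrite /dirichlet big1 ?mulr0// => x _; rewrite big1// => y _.
  by rewrite (X1 x y : y = x) subrr mulr0 mul0r.
by split; apply/seteqP; split => // t _ f _; rewrite D0.
Qed.

Lemma LS_sub_MLS t : 0 <= t -> LS_constants Q pi t ->
  MLS_constants Q pi (t / 2).
Proof.
move=> t0 tL f f0; apply: le_trans (tL f f0) _.
rewrite -mulrA ler_wpM2l//; apply: dirichlet_le => // x y _ /=.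
have s0 z : 0 < Num.sqrt (f z) by rewrite sqrtr_gt0.
by have := sqr_sub_le_ln (s0 x) (s0 y);
  rewrite !sqr_sqrtr ?(ltW (f0 _))// -expr2.
Qed.

Lemma regular_near_extremal s : (1 < #|X|)%N -> p <= 1 -> 0 <= s ->
  0 < t_LS Q pi -> s < t_LS Q pi ->
  exists g, [/\ forall x, 0 < g x, expect pi (fun x => g x ^+ 2) = 1,
    s * dirichlet Q pi g g < entropy pi (fun x => g x ^+ 2) &
    forall x y, allowed Q x y -> g y <= 2 / p * Num.max (g x) 1].
Proof.
move=> X2 p1 s0; set L := t_LS Q pi => L0 sL.
have pi0 := stationary_gt0 Qgen Qirr piP Qrev.
have p0 : 0 < p := sparsity_gt0 Qgen Qirr piP Qrev.
have J0 x : 0 < jump_rate Q x.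
  have [y xy] := exists_neighbour Qirr x X2.
  exact: lt_le_trans xy (jump_rate_ge1 Qgen xy).
have LSinf : has_inf (LS_constants Q pi).
  by apply: contrapT => /inf_out LE; move: L0; rewrite /L /t_LS LE ltxx.
have [M M0 DM] := dirichlet_bounded Q pi0.
(* A lower bound, uniform in the edge, for the energy saved by raising [g] across an irregular
   edge. *)
pose c := \big[Num.min/1]_x (pi x * jump_rate Q x).
have c0 : 0 < c by apply: lt_bigmin => // x _; rewrite mulr_gt0.
have cle x : c <= pi x * jump_rate Q x by exact: bigmin_le_cond.
(* The first bound keeps [L - e] above [s]; the second makes the slack [2 e M] at most the saving
   [L c]. *)
pose e := Num.min (L - s) (L * c / (2 * M)).
have e0 : 0 < e by rewrite lt_min subr_gt0 sL divr_gt0 ?mulr_gt0.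
have es : s <= L - e by have : e <= L - s; [rewrite ge_min lexx | lra].
have eM : 2 * e * M <= L * c.
  have : e <= L * c / (2 * M) by rewrite ge_min lexx orbT.
  by rewrite ler_pdivlMr ?mulr_gt0//; lra.
have [f [f0 fL]] : exists f, (forall x, 0 < f x) /\
    (L - e) * dirichlet Q pi (Num.sqrt \o f) (Num.sqrt \o f) < entropy pi f.
  have : ~ LS_constants Q pi (L - e).
    by move=> /(ge_inf LSinf.2); rewrite -/(t_LS Q pi) -/L; lra.
  move=> /existsNP[f /not_implyP[f0 /negP]]; rewrite -ltNge => h.
  by exists f.
have [t tL te] := inf_adherent e0 LSinf.
rewrite -/(t_LS Q pi) -/L in te.
have Lt : L <= t by exact: ge_inf LSinf.2 _ tL.
have Ef0 := expect_gt0 piP f0; set b := expect pi f in Ef0.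
have bV0 : 0 < b^-1 by rewrite invr_gt0.
pose g x := Num.sqrt (b^-1 * f x).
have g0 x : 0 < g x by rewrite sqrtr_gt0 mulr_gt0.
have gE x : g x ^+ 2 = b^-1 * f x by rewrite sqr_sqrtr// ltW// mulr_gt0.
have g1 : expect pi (fun x => g x ^+ 2) = 1.
  by rewrite (eq_expect pi gE) expectZ mulVf// gt_eqF.
have gL : (L - e) * dirichlet Q pi g g < entropy pi (fun x => g x ^+ 2).
  have -> : (fun x => g x ^+ 2) = (fun x => b^-1 * f x) by apply/funext.
  rewrite entropyZ//; apply: le_lt_trans (_ : _ <= b^-1 * _) _; last first.
    by rewrite ltr_pM2l//; exact: fL.
  rewrite [leRHS]mulrCA ler_wpM2l//; first exact: le_trans es.
  apply: dirichlet_le => // x y _ /=; rewrite /g !sqrtrM ?(ltW bV0)//.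
  rewrite -mulrBr mulrACA -expr2 sqr_sqrtr// ltW//.
exists g; split => //.
  apply: le_lt_trans gL; rewrite ler_wpM2r//; exact: dirichlet_sqr_ge0.
move=> x y xy; rewrite leNgt; apply/negP => irr.
have pQ := sparsity_jump_le Qgen Qirr piP Qrev xy.
(* Irregularity gives [2 A <= p * g y], so [p * pi x <= pi y] and [p <= 1] bound this mass by
   [pi y * g y ^+ 2 <= 1]. *)
have small : pi x * (2 * Num.max (g x) 1) ^+ 2 <= 1.
  have pxy := sparsity_stationary_le Qgen Qirr piP Qrev xy.
  have gy1 : pi y * g y ^+ 2 <= 1.
    rewrite -g1 /expect [leRHS](bigD1 y)//= lerDl sumr_ge0// => z _.
    by rewrite mulr_ge0 ?sqr_ge0// ltW.
  set A := Num.max (g x) 1 in irr *.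
  have A1 : 1 <= A by rewrite le_max lexx orbT.
  have h : (2 * A) ^+ 2 <= (p * g y) ^+ 2.
    have : 2 * A <= p * g y.
      have -> : 2 * A = p * (2 / p * A) by field; rewrite gt_eqF.
      by rewrite ler_wpM2l// ltW.
    by move=> h; rewrite ler_sqr// nnegrE
      mulr_ge0 ?(ltW p0) ?(ltW (g0 y))//; lra.
  apply: le_trans (ler_wpM2l (ltW (pi0 x)) h) _.
  have -> : pi x * (p * g y) ^+ 2 = p * (p * pi x * g y ^+ 2) by ring.
  apply: le_trans (_ : p * (pi y * g y ^+ 2) <= _).
    by rewrite ler_wpM2l ?ler_wpM2r ?sqr_ge0// ltW.
  by apply: mulr_ile1 => //; rewrite ?mulr_ge0 ?sqr_ge0// ltW.
have hE := entropy_raise piP g0 g1 small.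
have hD := dirichlet_raise Qgen piP Qrev p0 pQ (allowed_neq Qgen xy) g0 irr.
set g' := update g x _ in hE hD.
have g'0 z : 0 < g' z.
  by rewrite /g' /update; case: ifP => // _;
    rewrite mulr_gt0// lt_max ltr01 orbT.
have := tL (fun z => g' z ^+ 2) (fun z => exprn_gt0 2 (g'0 z)).
have -> : Num.sqrt \o (fun z => g' z ^+ 2) = g'.
  by apply/funext => z /=; rewrite sqrtr_sqr gtr0_norm.
have t0 : 0 <= t by lra.
move=> tE; have h1 := ler_wpM2l t0 hD.
have h2 := DM g g0 g1.
(* Chaining [gL], [hE], [tE] and [h1] gives [t * (pi x * jump_rate Q x) < (t - (L - e)) * dirichlet
   Q pi g g], against [h4], [eM] and [h5]. *)
have h3 := dirichlet_sqr_ge0 Qgen piP g.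
have h4 : (t - (L - e)) * dirichlet Q pi g g <= 2 * e * M.
  apply: ler_pM => //; lra.
have h5 : L * c <= t * (pi x * jump_rate Q x).
  by apply: ler_pM => //; exact: ltW.
lra.
Qed.

Lemma t_LS_le_MLS t : (1 < #|X|)%N -> p <= 1 / 2 -> MLS_constants Q pi t ->
  t_LS Q pi <= 20 * t * ln (1 / p).
Proof.
move=> X2 p2 tM; have t0 := MLS_constant_ge0 Qgen Qirr piP Qrev X2 tM.
have p0 : 0 < p := sparsity_gt0 Qgen Qirr piP Qrev.
have lp0 : 0 <= ln (1 / p) by rewrite ln_ge0// ler_pdivlMr//; lra.
rewrite leNgt; apply/negP => LT.
have p1 : p <= 1 by lra.
have T0 : 0 <= 20 * t * ln (1 / p) by rewrite !mulr_ge0.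
have [g [g0 g1 gL reg]] :=
  regular_near_extremal X2 p1 T0 (le_lt_trans T0 LT) LT.
have k1 : 1 < 2 / p by rewrite ltr_pdivlMr//; lra.
have := MLS_entropy_regular Qgen piP tM t0 k1 g0 g1 reg
  (allowed_sym Qgen Qirr piP Qrev).
apply/negP; rewrite -ltNge; apply: le_lt_trans gL.
rewrite ler_wpM2r ?dirichlet_sqr_ge0// [20 * t]mulrC -mulrA ler_wpM2l//.
exact: reg_cost_sparse.
Qed.

End Main.

(** For two states with rates [a] and [b], [p = min(a, b) / max(a, b)]. If [a = b], then
    [ln (1 / p) = 0] although [t_LS] is positive; [two_states] excludes such cases. *)
Theorem theorem1 (R : realType) (X : finType) (Q : X -> X -> R) (pi : X -> R)
  (Qgen : generator Q) (Qirr : irreducible Q)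
  (piP : probability_mass pi) (Qrev : reversible Q pi)
  (two_states : #|X| = 2%N -> sparsity Q <= 1 / 2) :
  t_LS Q pi <= 20 * t_MLS Q pi * ln (1 / sparsity Q).
Proof.
have [X1|X2] := leqP #|X| 1.
  have infT : inf (@setT R) = 0.
    apply: inf_out => -[_ [b lb]].
    by have := lb (b - 1) I; rewrite lerBrDr gerDl ler10.
  have [LE ME] := LS_constants_single Q piP X1.
  by rewrite /t_LS /t_MLS LE ME infT mulr0 mul0r.
have p2 : sparsity Q <= 1 / 2.
  move: X2; rewrite leq_eqVlt => /predU1P[/esym//|].
  exact: (sparsity_le_half Qgen Qirr piP Qrev).
have p0 := sparsity_gt0 Qgen Qirr piP Qrev.
have lp : 0 < ln (1 / sparsity Q) by rewrite ln_gt0// ltr_pdivlMr//; lra.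
have M0 t : MLS_constants Q pi t -> 0 <= t.
  exact: (MLS_constant_ge0 Qgen Qirr piP Qrev).
(* If [t_LS] is nonpositive, in particular if it takes the default value 0, the sign of [t_MLS]
   suffices. If it is positive, [LS_constants] has a genuine infimum. *)
have [L0|L0] := leP (t_LS Q pi) 0.
  apply: (le_trans L0); rewrite mulr_ge0 ?(ltW lp)// mulr_ge0//.
  have [Mne|/set0P/negP/negPn/eqP M_eq0] :=
    pselect (MLS_constants Q pi !=set0)%classic.
    exact: lb_le_inf.
  by rewrite /t_MLS M_eq0 inf0.
have LSinf : has_inf (LS_constants Q pi).
  by apply: contrapT => /inf_out LE; move: L0; rewrite /t_LS LE ltxx.
have [[t tL] lb] := LSinf.
have t0 : 0 <= t by apply: le_trans (ltW L0) _; exact: ge_inf.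
rewrite mulrAC -ler_pdivrMl; last by rewrite mulr_gt0.
apply: lb_le_inf.
  (* Nonemptiness excludes the default value 0 of [t_MLS]. *)
  by exists (t / 2); exact: LS_sub_MLS.
move=> u uM; rewrite ler_pdivrMl ?mulr_gt0// mulrAC.
exact: t_LS_le_MLS.
Qed.
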